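(* Let $n\in\mathbb{N}_0$ and define $$y\left(n,\tfrac12\right)=\sum_{j=0}^{n}\frac{(-1)^{n}}{(j+1)\left(\tfrac12\right)^{j+1}\left(\tfrac12-1\right)^{n+1-j}}.$$ Then $$y\left(n,\tfrac12\right)=2^{n+2}\left(H_{\lfloor n/2\rfloor}-H_n+\frac{(-1)^{n+1}}{n+1}\right),$$ where $H_m=\sum_{k=1}^m\frac1k$ denotes the $m$-th harmonic number, with $H_0=0$, and $\lfloor\cdot\rfloor$ is the integer part. *)

(* Defs.v *)
From mathcomp Require Import all_boot all_order all_algebra.
Set Implicit Arguments.
Unset Strict Implicit.
Unset Printing Implicit Defensive.
Import GRing.Theory.
Local Open Scope ring_scope.

Definition y (R : fieldType) (n : nat) (lambda : R) : R :=
  \sum_(0 <= j < n.+1)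
    (-1) ^+ n /
    (j.+1%:R * lambda ^+ j.+1 * (lambda - 1) ^+ (n + 1 - j)%N).

Definition harmonic_number (R : fieldType) (m : nat) : R :=
  \sum_(1 <= k < m.+1) 1 / k%:R.

(* Main.v *)
Require Import Defs.
From mathcomp Require Import all_boot all_order all_algebra.
From mathcomp Require Import ring.
Import GRing.Theory Num.Theory.
Local Open Scope ring_scope.

(** At [lambda = 1/2] the [j]-th summand is [2 ^ (n + 2) * (-1) ^ (j + 1) / (j + 1)],
    so [y n (1/2)] is a multiple of an alternating harmonic sum; up to index [n]
    that sum is twice the sum of the even-index terms, [H_(n/2)], minus [H_n]. *)

Lemma harmonic_numberS (R : fieldType) (m : nat) :
  harmonic_number R m.+1 = harmonic_number R m + m.+1%:R^-1.
Proof. by rewrite /harmonic_number big_nat_recr //= div1r. Qed.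

Lemma alternating_harmonic_sum (R : numFieldType) (n : nat) :
  \sum_(0 <= j < n) (-1) ^+ j.+1 / j.+1%:R =
  harmonic_number R (n %/ 2) - harmonic_number R n.
Proof.
rewrite divn2; elim: n => [|n IHn]; first by rewrite big_geq // subrr.
rewrite big_nat_recr //= {}IHn harmonic_numberS uphalf_half -signr_odd /=.
(* [H_(n/2)] gains a term only for odd [n]: it equals 2/(n+1), and subtracting the new 1/(n+1) of
   [H_(n+1)] leaves +1/(n+1). *)
case: (boolP (odd n)) => odd_n; last by rewrite add0n expr1 mulN1r opprD addrA.
rewrite add1n harmonic_numberS expr0.
have -> : n.+1%:R = 2 * (n./2).+1%:R :> R.
  by rewrite -natrM mul2n doubleS -[in LHS](odd_double_half n) odd_n.
by field; rewrite nat1r pnatr_eq0.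
Qed.

Lemma y_half_summand (R : numFieldType) (n j : nat) : (j <= n)%N ->
  (-1) ^+ n / (j.+1%:R * (1 / 2) ^+ j.+1 * (1 / 2 - 1) ^+ (n + 1 - j)) =
  2 ^+ (n + 2) * ((-1) ^+ j.+1 / j.+1%:R) :> R.
Proof.
move=> /subnKC <-; move: (n - j)%N => k.
have -> : (j + k + 1 - j = k.+1)%N by rewrite -addnA addKn addn1.
have -> : (j + k + 2 = j.+1 + k.+1)%N by rewrite addn2 addSn addnS.
have -> : 1 / 2 - 1 = - 2^-1 :> R by field.
rewrite div1r (exprNn 2^-1) !invfM !exprVn !invrK invr_sign !exprD !exprS.
(* The left side carries (-1)^k twice, so its square, which is 1, is inserted on the right. *)
rewrite -[RHS](signrMK k); ring.
Qed.

Theorem theorem3 (R : numFieldType) (n : nat) :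
  y n (1 / 2 : R) =
  2 ^+ (n + 2)%N *
  (harmonic_number R (n %/ 2)%N - harmonic_number R n
   + (-1) ^+ (n + 1)%N / (n + 1)%:R).
Proof.
rewrite -alternating_harmonic_sum addn1.
(* The harmonic difference covers [j < n]; the separate fraction is the summand at [j = n]. *)
rewrite -(big_nat_recr n 0 (fun j => (-1) ^+ j.+1 / j.+1%:R)) //= mulr_sumr.
by apply: eq_big_nat => j /andP[_ le_jn]; apply: y_half_summand.
Qed.
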